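(* Let $(B,\lfloor\cdot,\cdot\rfloor)$ be an SSD space and $A\subseteq B$ a maximally $q$-positive set. Define $E^A,E_A:\mathbb{R}_+\rightrightarrows B$ by $E^A(\varepsilon)=\{b\in B:q(b-c)\geq-\varepsilon\text{ for all }c\in A\}$ and $E_A(\varepsilon)=\bigcap_{E\in\mathbb{E}(A)}E(\varepsilon)$ for all $\varepsilon\geq 0$. Then: (i) $E_A,E^A\in\mathbb{E}(A)$; (ii) $E_A$ and $E^A$ are, respectively, the smallest and the biggest elements in $\mathbb{E}(A)$ with respect to the partial ordering given by inclusion of graphs, that is, $G(E_A)\subseteq G(E)\subseteq G(E^A)$ for all $E\in\mathbb{E}(A)$.
   Context: A symmetrically self-dual space (SSD space) is a pair $(B,\lfloor\cdot,\cdot\rfloor)$ where $B$ is a nonzero real vector space and $\lfloor\cdot,\cdot\rfloor:B\times B\to\mathbb{R}$ is a symmetric bilinear form. Put $q:B\to\mathbb{R}$, $q(b)=\frac12\lfloor b,b\rfloor$. A set $A\subseteq B$ is $q$-positive if $A\neq\emptyset$ and $q(b-c)\geq 0$ for all $b,c\in A$; it is maximally $q$-positive if it is $q$-positive and maximal with respect to inclusion among the $q$-positive subsets of $B$. $\mathbb{R}_+=[0,+\infty)$. The graph of $E:\mathbb{R}_+\rightrightarrows B$ is $G(E)=\{(\varepsilon,b)\in\mathbb{R}_+\times B: b\in E(\varepsilon)\}$. A multifunction $E:\mathbb{R}_+\rightrightarrows B$ satisfies the transportation formula if for all $\varepsilon_1,\varepsilon_2\geq 0$, $b^1\in E(\varepsilon_1)$,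 $b^2\in E(\varepsilon_2)$ and all $\alpha_1,\alpha_2\geq 0$ with $\alpha_1+\alpha_2=1$ one has $\varepsilon:=\alpha_1\varepsilon_1+\alpha_2\varepsilon_2+\alpha_1\alpha_2 q(b^1-b^2)\geq 0$ and $\alpha_1b^1+\alpha_2b^2\in E(\varepsilon)$. $\mathbb{E}(A)$ is the family of multifunctions $E:\mathbb{R}_+\rightrightarrows B$ such that: (r1) $E$ is an enlargement of $A$, i.e. $A\subseteq E(\varepsilon)$ for all $\varepsilon\geq 0$; (r2) $E$ is nondecreasing, i.e. $0\leq\varepsilon_1\leq\varepsilon_2$ implies $E(\varepsilon_1)\subseteq E(\varepsilon_2)$; (r3) $E$ satisfies the transportation formula. *)

(* Defs.v *)
From HB Require Import structures.
From mathcomp Require Import all_boot all_order all_algebra.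
From mathcomp Require Import interval_inference.
From mathcomp Require Import classical_sets reals.

Set Implicit Arguments.
Unset Strict Implicit.
Unset Printing Implicit Defensive.

Import Order.TTheory GRing.Theory Num.Theory.
Local Open Scope classical_set_scope.
Local Open Scope ring_scope.

Section SSD.
Context {R : realType} {B : lmodType R}.
Implicit Types (form : {symmetric B}) (A : set B) (E : {nonneg R} -> set B).

Definition quad form (b : B) : R := 2^-1 * form b b.

Definition q_positive form A : Prop :=
  A !=set0 /\ forall b c, A b -> A c -> 0 <= quad form (b - c).

Definition maximally_q_positive form A : Prop :=
  q_positive form A /\
  forall C : set B, q_positive form C -> A `<=` C -> C `<=` A.

Definition graph E : set ({nonneg R} * B) := [set eb | E eb.1 eb.2].

Definition is_enlargement A E : Prop := forall e, A `<=` E e.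

Definition nondecreasing_mf E : Prop :=
  forall e1 e2 : {nonneg R}, e1%:num <= e2%:num -> E e1 `<=` E e2.

(* [NngNum e_ge0] is the real number [e] seen as an element of R_+, so the
   nonnegativity of [e] is part of the conclusion. *)
Definition transportation_formula form E : Prop :=
  forall (e1 e2 : {nonneg R}) (b1 b2 : B) (a1 a2 : R),
    E e1 b1 -> E e2 b2 -> 0 <= a1 -> 0 <= a2 -> a1 + a2 = 1 ->
    let e := a1 * e1%:num + a2 * e2%:num + a1 * a2 * quad form (b1 - b2) in
    exists e_ge0 : 0 <= e, E (NngNum e_ge0) (a1 *: b1 + a2 *: b2).

Definition enlargements form A : set ({nonneg R} -> set B) :=
  [set E | [/\ is_enlargement A E, nondecreasing_mf E &
               transportation_formula form E]].

Definition enlargement_upper form A (e : {nonneg R}) : set B :=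
  [set b | forall c, A c -> - e%:num <= quad form (b - c)].

Definition enlargement_lower form A (e : {nonneg R}) : set B :=
  \bigcap_(E in enlargements form A) E e.

End SSD.

(* Main.v *)
Require Import Defs.
From mathcomp Require Import all_boot all_order all_algebra.
From mathcomp Require Import interval_inference classical_sets reals.
From mathcomp Require Import ring lra.

Import Order.TTheory GRing.Theory Num.Theory.
Local Open Scope classical_set_scope.
Local Open Scope ring_scope.

(** Everything rests on the convexity defect of a quadratic form: for
    [a1 + a2 = 1] the gap between [a1 * q b1 + a2 * q b2] and
    [q (a1 *: b1 + a2 *: b2)] is exactly [a1 * a2 * q (b1 - b2)]
    ([quad_conv]), the correction term of the transportation formula. Applied
    to [b1 - c] and [b2 - c] with [c] in [A], it propagates the inequalities
    that define [E^A] along convex combinations. The resulting level is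
    nonnegative because maximality of [A] leaves no point lying at a uniformly
    positive level above [A] ([maximal_level_ge0]); hence [E^A] is in the
    family.

    Conversely, a member [E] of the family contains [A] at level [0]. Applying
    its transportation formula to [b] in [E e] and [c] in [A], and letting the
    weight of [c] tend to [1], the mere nonnegativity of the level gives
    [q (b - c) >= - e], that is, [E] lies below [E^A]
    ([enlargement_sub_upper]).

    The conditions (r1)-(r3) pass to intersections of nonempty families, and
    the family contains [E^A], so [E_A] belongs to it; by construction it is
    the smallest member. *)

Section Enlargements.
Set Implicit Arguments.
Unset Strict Implicit.
Context {R : realType} {B : lmodType R} (form : {symmetric B}).
Implicit Types (A : set B) (b c : B) (a : R).

Local Notation q := (quad form).

Lemma form_sym b c : form b c = form c b.
Proof. by rewrite hermC /= expr0 mul1r. Qed.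

Lemma quad0 : q 0 = 0.
Proof. by rewrite /quad linear0l mulr0. Qed.

Lemma quadN b : q (- b) = q b.
Proof. by rewrite /quad linearNl linearNr opprK. Qed.

Lemma quadBC b c : q (b - c) = q (c - b).
Proof. by rewrite -quadN opprB. Qed.

Lemma quad_conv a1 a2 b1 b2 : a1 + a2 = 1 ->
  q (a1 *: b1 + a2 *: b2) = a1 * q b1 + a2 * q b2 - a1 * a2 * q (b1 - b2).
Proof.
move=> a12; have -> : a2 = 1 - a1 by rewrite -a12 addrC addKr.
rewrite /quad !(linearDl, linearDr, linearZl_LR, linearZr_LR, linearNl,
  linearNr) /= (form_sym b2 b1).
by field.
Qed.

(** Points at nonnegative level with respect to all of [A] can be added to it
    without losing q-positivity. *)
Lemma maximal_mem A b : maximally_q_positive form A ->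
  (forall c, A c -> 0 <= q (b - c)) -> A b.
Proof.
move=> [[[c0 Ac0] A_pos] A_max] b_pos.
apply: (A_max (A `|` [set b])); [split|by move=> c Ac; left|by right].
  by exists c0; left.
move=> x y [Ax|->] [Ay|->].
- exact: A_pos.
- by rewrite quadBC; exact: b_pos.
- exact: b_pos.
- by rewrite subrr quad0.
Qed.

(** If [e < 0], then [b] belongs to [A] by maximality, and [c := b] gives
    [- e <= q 0 = 0]. *)
Lemma maximal_level_ge0 A b (e : R) : maximally_q_positive form A ->
  (forall c, A c -> - e <= q (b - c)) -> 0 <= e.
Proof.
move=> A_max b_lb; rewrite leNgt; apply/negP => e_lt0.
have Ab : A b.
  by apply: maximal_mem A_max _ => c /b_lb; apply: le_trans; rewrite oppr_ge0 ltW.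
by move: (b_lb b Ab); rewrite subrr quad0 oppr_le0 leNgt e_lt0.
Qed.

Lemma enlargement_upper_mem A : maximally_q_positive form A ->
  enlargements form A (enlargement_upper form A).
Proof.
move=> A_max; split.
- move=> e b Ab c Ac; apply: (@le_trans _ _ 0); first by rewrite oppr_le0.
  exact: A_max.1.2.
- by move=> e1 e2 le12 b b_lb c /b_lb; apply: le_trans; rewrite lerN2.
- move=> e1 e2 b1 b2 a1 a2 b1_lb b2_lb a1_ge0 a2_ge0 a12 e.
  have b_lb c : A c -> - e <= q (a1 *: b1 + a2 *: b2 - c).
    move=> Ac.
    have -> : a1 *: b1 + a2 *: b2 - c = a1 *: (b1 - c) + a2 *: (b2 - c).
      by rewrite !scalerBr addrACA -opprD -scalerDl a12 scale1r.
    rewrite quad_conv // opprB addrA subrK /e.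
    have := ler_wpM2l a1_ge0 (b1_lb c Ac).
    have := ler_wpM2l a2_ge0 (b2_lb c Ac).
    lra.
  by exists (maximal_level_ge0 A_max b_lb).
Qed.

(** Closure of (r1)-(r3) under intersection; [E^A] is used only as a witness
    that the family is nonempty, which makes the levels nonnegative. *)
Lemma enlargement_lower_mem A : maximally_q_positive form A ->
  enlargements form A (enlargement_lower form A).
Proof.
move=> A_max; split.
- by move=> e b Ab E [E_enl _ _]; exact: E_enl.
- move=> e1 e2 le12 b Eb E E_in; have [_ E_mono _] := E_in.
  exact: E_mono le12 _ (Eb E E_in).
- move=> e1 e2 b1 b2 a1 a2 Eb1 Eb2 a1_ge0 a2_ge0 a12 e.
  have trans E : enlargements form A E ->
      exists e_ge0 : 0 <= e, E (NngNum e_ge0) (a1 *: b1 + a2 *: b2).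
    move=> E_in; have [_ _ E_trans] := E_in.
    exact: E_trans (Eb1 E E_in) (Eb2 E E_in) a1_ge0 a2_ge0 a12.
  have [e_ge0 _] := trans _ (enlargement_upper_mem A_max).
  exists e_ge0 => E /trans [e_ge0' Eb].
  by rewrite (bool_irrelevance e_ge0 e_ge0').
Qed.

Lemma enlargement_sub_upper A (E : {nonneg R} -> set B) (e : {nonneg R}) :
  enlargements form A E -> E e `<=` enlargement_upper form A e.
Proof.
move=> [E_enl _ E_trans] b Eb c Ac; rewrite leNgt; apply/negP => q_lt.
have e_ge0 : 0 <= e%:num by [].
have q_lt0 : q (b - c) < 0 by lra.
(* Dividing the level by the weight [1 - t] of [b] leaves
   [e + t * q (b - c)], and this [t < 1] makes it half of the negative
   number [e + q (b - c)]. *)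
pose t := (q (b - c) - e%:num) / (2 * q (b - c)).
have tq : t * q (b - c) = (q (b - c) - e%:num) / 2.
  by rewrite /t; field; rewrite lt_eqF.
have t_ge0 : 0 <= t by nra.
have t_lt1 : t < 1 by nra.
have t1_ge0 : 0 <= 1 - t by rewrite subr_ge0 ltW.
have [level_ge0 _] := E_trans e (NngNum (lexx 0)) b c (1 - t) t Eb
  (E_enl _ _ Ac) t1_ge0 t_ge0 (subrK _ _).
move: level_ge0; rewrite /= mulr0 addr0 -mulrA -mulrDr pmulr_rge0 ?subr_gt0 //.
rewrite tq; lra.
Qed.

End Enlargements.

Theorem proposition5 (R : realType) (B : lmodType R) (form : {symmetric B})
    (B_nonzero : exists b : B, b != 0)
    (A : set B) (A_max : maximally_q_positive form A) :
  (enlargements form A (enlargement_lower form A) /\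
   enlargements form A (enlargement_upper form A)) /\
  (forall E : {nonneg R} -> set B, enlargements form A E ->
     graph (enlargement_lower form A) `<=` graph E /\
     graph E `<=` graph (enlargement_upper form A)).
Proof.
split.
  by split; [exact: enlargement_lower_mem | exact: enlargement_upper_mem].
move=> E E_in; split=> -[e b].
  by move=> Eb; exact: Eb E E_in.
exact: enlargement_sub_upper E_in b.
Qed.
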